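(* Let $V$ be a generalized complex vector space and let $W\subseteq V$ be a split subspace. Then $W$ is a generalized complex subspace of $V$. Furthermore, $W$ satisfies the graph condition with respect to the induced generalized complex structure.
   Context: All vector spaces are finite-dimensional. For a real vector space $V$, $V_{\mathbb C}$ is its complexification, with complex conjugation $x\mapsto\bar x$; for $U\subseteq V$, $\operatorname{Ann}(U)\subseteq V^*$ is the annihilator. On $V\oplus V^*$ (and its complexification) use the pairing $\langle v+f,w+g\rangle=-\tfrac12(f(w)+g(v))$. A generalized complex (GC) structure on $V$ is an $\mathbb R$-linear automorphism $\mathcal J$ of $V\oplus V^*$ that is orthogonal for $\langle\cdot,\cdot\rangle$ and satisfies $\mathcal J^2=-1$. Equivalently, it is a maximally isotropic complex subspace $E\subset V_{\mathbb C}\oplus V_{\mathbb C}^*$ with $E\cap\overline E=(0)$; $E$ is the $+i$-eigenspace of $\mathcal J$. Write $\mathcal J=\begin{pmatrix}\mathcal J_1&\mathcal J_2\\ \mathcal J_3&\mathcal J_4\end{pmatrix}$ with $\mathcal J_1:V\to V$, $\mathcal J_2:V^*\to V$, $\mathcal J_3:V\to V^*$, $\mathcal J_4:V^*\to V^*$. A GC vector space is a real vector space with a GC structure. GC subspace: for a real subspace $W\subseteq V$ put $E_W=\{(w,f|_{W_{\mathbb C}}) : (w,f)\in E\cap(W_{\mathbb C}\oplus V_{\mathbb C}^* )\}$ (always a maximally isotropic subspace of $W_{\mathbb C}\oplus W_{\mathbb C}^*$). $W$ is a GC subspace if $E_W\cap\overline{E_W}=(0)$; then $E_W$ is the induced GC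 structure on $W$. Split: $W\subseteq V$ is split if there is a subspace $N\subseteq V$ with $V=W\oplus N$ and $W\oplus\operatorname{Ann}(N)\subseteq V\oplus V^*$ stable under $\mathcal J$. Direct sum and twist: the direct sum of GC structures $\mathcal J_U$ on $U$ and $\mathcal J_V$ on $V$ is the structure on $U\oplus V$ given by $\mathcal J_U\oplus\mathcal J_V$ under the natural identification $(U\oplus V)\oplus(U\oplus V)^*\cong U\oplus U^*\oplus V\oplus V^*$. The twist of $\mathcal J$ is $\tilde{\mathcal J}=\begin{pmatrix}\mathcal J_1&-\mathcal J_2\\ -\mathcal J_3&\mathcal J_4\end{pmatrix}$. If $(W,\mathcal J_W)$, $(V,\mathcal J_V)$ are GC vector spaces, the twisted product structure on $W\oplus V$ is the direct sum of $\tilde{\mathcal J}_W$ and $\mathcal J_V$. A subspace $U$ of a GC vector space $(X,\mathcal J)$ is generalized isotropic if $\mathcal J(U)\subseteq U\oplus\operatorname{Ann}(U)$. A subspace $W\subseteq V$ equipped with a GC structure $\mathcal J_W$ satisfies the graph condition (with respect to $\mathcal J_W$) if the graph $\{(w,w):w\in W\}\subseteq W\oplus V$ of the inclusion is generalized isotropic for the twisted product structure on $W\oplus V$. *)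

(* Defs.v *)
From HB Require Import structures.
From mathcomp Require Import all_boot all_order all_algebra.
From mathcomp Require Import complex.
From mathcomp Require Import reals.

Set Implicit Arguments.
Unset Strict Implicit.
Unset Printing Implicit Defensive.

Import GRing.Theory.

Local Open Scope ring_scope.
Local Open Scope complex_scope.

Definition dual (K : fieldType) (V : vectType K) : vectType K := 'Hom(V, K^o).

Section LinearAlgebra.
Variable K : fieldType.
Implicit Types U V W : vectType K.

Definition prodv U V (A : {vspace U}) (B : {vspace V}) : {vspace U * V} :=
  (linfun fst @^-1: A :&: linfun snd @^-1: B)%VS.

Lemma mem_prodv U V (A : {vspace U}) (B : {vspace V}) x :
  (x \in prodv A B) = (x.1 \in A) && (x.2 \in B).
Proof. by rewrite /prodv memv_cap -!memv_preim !lfunE. Qed.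

Definition incl V (W : {vspace V}) : 'Hom(subvs_of W, V) := linfun vsval.

Lemma inclE V (W : {vspace V}) w : incl W w = vsval w.
Proof. exact: lfunE. Qed.

Definition precomp U V (g : 'Hom(U, V)) (f : dual V) : dual U := (f \o g)%VF.

Lemma precomp_is_linear U V (g : 'Hom(U, V)) : linear (precomp g).
Proof.
move=> a f1 f2; apply/lfunP => x.
by rewrite !(comp_lfunE, add_lfunE, scale_lfunE).
Qed.
HB.instance Definition _ U V (g : 'Hom(U, V)) :=
  GRing.isLinear.Build K (dual V) (dual U) _ (precomp g) (precomp_is_linear g).

Definition Ann V (W : {vspace V}) : {vspace dual V} :=
  lker (linfun (precomp (incl W))).

Lemma AnnP V (W : {vspace V}) (f : dual V) :
  reflect (forall w, w \in W -> f w = 0) (f \in Ann W).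
Proof.
rewrite memv_ker lfunE /=; apply: (iffP eqP) => [f0 w wW | f0].
  by move/lfunP: f0 => /(_ (Subvs wW)); rewrite comp_lfunE inclE zero_lfunE.
apply/lfunP => w; rewrite comp_lfunE inclE zero_lfunE.
exact/f0/subvsP.
Qed.

End LinearAlgebra.

(* The pair (x, y) : cplx V stands for x + i y. *)
Definition cplx (R : rcfType) (V : vectType R) : Type := (V * V)%type.

Section Complexification.
Variable R : rcfType.
Implicit Types U V W : vectType R.

HB.instance Definition _ V := GRing.Zmodule.on (cplx V).

Section Scale.
Variable V : vectType R.

Definition cscale (c : R[i]) (z : cplx V) : cplx V :=
  (Re c *: z.1 - Im c *: z.2, Re c *: z.2 + Im c *: z.1).

Lemma cscaleA a b z : cscale a (cscale b z) = cscale (a * b) z.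
Proof.
case: a b z => [a1 a2] [b1 b2] [x y]; rewrite /cscale /=; congr (_, _).
  rewrite !scalerBr !scalerDr scalerBl scalerDl !scalerA !opprD.
  by rewrite [X in _ + X = _]addrC addrACA.
rewrite !scalerBr !scalerDr scalerBl scalerDl !scalerA.
by rewrite [X in _ + X = _]addrC addrACA.
Qed.

Lemma cscale1 : left_id 1 cscale.
Proof. by case=> x y; rewrite /cscale /= !scale1r !scale0r subr0 addr0. Qed.

Lemma cscaleDr : right_distributive cscale +%R.
Proof.
move=> c [x1 y1] [x2 y2]; rewrite /cscale /=; congr (_, _).
  by rewrite !scalerDr opprD addrACA.
by rewrite !scalerDr addrACA.
Qed.

Lemma cscaleDl z : {morph cscale^~ z : a b / a + b}.
Proof.
case: z => x y [a1 a2] [b1 b2]; rewrite /cscale /=; congr (_, _).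
  by rewrite !scalerDl opprD addrACA.
by rewrite !scalerDl addrACA.
Qed.

HB.instance Definition _ := GRing.Zmodule_isLmodule.Build R[i] (cplx V)
  cscaleA cscale1 cscaleDr cscaleDl.

Lemma cscaleE (c : R[i]) (z : cplx V) : c *: z = cscale c z.
Proof. by []. Qed.

Lemma cplx_vector_axiom : vector_axiom_def (\dim {:V}) (cplx V).
Proof.
pose e := vbasis {:V}.
pose f (z : cplx V) : 'rV[R[i]]_(\dim {:V}) :=
  \row_j (coord e j z.1 +i* coord e j z.2).
pose g (u : 'rV[R[i]]_(\dim {:V})) : cplx V :=
  (\sum_j Re (u 0 j) *: e`_j, \sum_j Im (u 0 j) *: e`_j).
exists f.
  move=> [a b] [x1 y1] [x2 y2]; apply/rowP => j; rewrite !mxE /=.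
  by rewrite !linearD !linearN /= !linearZ.
have e_free : free e := basis_free (vbasisP _).
exists g => [[x y] | u].
  rewrite [RHS]surjective_pairing /= [in RHS](coord_vbasis (memvf x)).
  rewrite [in RHS](coord_vbasis (memvf y)).
  by congr (_, _); apply: eq_bigr => j _; rewrite mxE.
by apply/rowP => j; rewrite !mxE !coord_sum_free //; case: (u 0 j).
Qed.

HB.instance Definition _ :=
  Lmodule_hasFinDim.Build R[i] (cplx V) cplx_vector_axiom.

End Scale.

Definition conjx V (z : cplx V) : cplx V := (z.1, - z.2).

Definition conjv V (E : {vspace cplx V}) : {vspace cplx V} :=
  <<[seq conjx z | z <- vbasis E]>>%VS.

Definition cplx_map U V (f : 'Hom(U, V)) (z : cplx U) : cplx V :=
  (f z.1, f z.2).

Lemma cplx_map_is_linear U V (f : 'Hom(U, V)) : linear (cplx_map f).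
Proof.
move=> c [x1 y1] [x2 y2]; congr (_, _) => /=.
  by rewrite linearD linearB !linearZ.
by rewrite linearD linearD !linearZ.
Qed.
HB.instance Definition _ U V (f : 'Hom(U, V)) :=
  GRing.isLinear.Build R[i] (cplx U) (cplx V) _ (cplx_map f)
    (cplx_map_is_linear f).

Definition cplxf U V (f : 'Hom(U, V)) : 'Hom(cplx U, cplx V) :=
  linfun (cplx_map f).

Lemma cplxfE U V (f : 'Hom(U, V)) z : cplxf f z = cplx_map f z.
Proof. exact: lfunE. Qed.

Definition cplxv V (W : {vspace V}) : {vspace cplx V} :=
  limg (cplxf (incl W)).

Lemma mem_cplxv V (W : {vspace V}) (z : cplx V) :
  (z \in cplxv W) = (z.1 \in W) && (z.2 \in W).
Proof.
apply/memv_imgP/andP => [[w _ ->] | [z1 z2]].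
  by rewrite cplxfE /= !inclE; split; apply: subvsP.
exists ((Subvs z1, Subvs z2) : cplx _); rewrite ?memvf // cplxfE /cplx_map /=.
by rewrite !inclE; case: z z1 z2.
Qed.

Lemma conjxD V : {morph @conjx V : x y / x + y}.
Proof. by move=> [a b] [c d]; congr (_, _); rewrite /= opprD. Qed.

Lemma conjxZ V (c : R[i]) (z : cplx V) : conjx (c *: z) = c^* *: conjx z.
Proof.
case: c z => a b [x y]; congr (_, _) => /=.
  by rewrite scalerN scaleNr !opprK.
by rewrite opprD scalerN scaleNr.
Qed.

Lemma conjxK V : involutive (@conjx V).
Proof. by case=> x y; rewrite /conjx /= opprK. Qed.

Lemma mem_conjv V (E : {vspace cplx V}) z : (z \in conjv E) = (conjx z \in E).
Proof.
have conj_sum n (c : 'I_n -> R[i]) (F : 'I_n -> cplx V) :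
  conjx (\sum_i c i *: F i) = \sum_i (c i)^* *: conjx (F i).
  elim/big_rec2: _ => [|i u v _ <-]; last by rewrite conjxD conjxZ.
  by congr (_, _); rewrite /= oppr0.
rewrite /conjv; apply/idP/idP => [zE | /coord_vbasis zE].
  rewrite (coord_span (X := map_tuple (@conjx V) (vbasis E)) zE) conj_sum.
  apply: memv_suml => i _; apply: memvZ.
  by rewrite (nth_map 0) ?size_tuple // conjxK vbasis_mem ?mem_nth ?size_tuple.
rewrite -[z]conjxK zE conj_sum; apply: memv_suml => i _; apply/memvZ/memv_span.
by apply: map_f; rewrite mem_nth ?size_tuple.
Qed.

End Complexification.

Section GeneralizedComplex.
Variable R : realType.
Implicit Types U V W X : vectType R.

Definition gspace V : vectType R := (V * dual V)%type.

Definition pairing V (x y : gspace V) : R := - 2^-1 * (x.2 y.1 + y.2 x.1).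

Definition gc_structure V (J : 'End(gspace V)) : Prop :=
  (forall x y, pairing (J x) (J y) = pairing x y) /\ (forall x, J (J x) = - x).

(* V_C + V_C^* is identified with the complexification of V + V^*. *)
Definition gc_eigenspace V (J : 'End(gspace V)) : {vspace cplx (gspace V)} :=
  passmx.leigenspace (cplxf J) 'i%C.

Lemma mem_gc_eigenspace V (J : 'End(gspace V)) (z : cplx (gspace V)) :
  (z \in gc_eigenspace J) = (J z.1 == - z.2) && (J z.2 == z.1).
Proof.
rewrite memv_ker add_lfunE opp_lfunE scale_lfunE id_lfunE cplxfE subr_eq0.
case: z => x y; rewrite cscaleE /cscale /cplx_map xpair_eqE /=.
by rewrite !scale0r !scale1r sub0r add0r.
Qed.

Definition gproj V (W : {vspace V}) (x : gspace V) : gspace (subvs_of W) :=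
  (vsproj W x.1, precomp (incl W) x.2).

Lemma gproj_is_linear V (W : {vspace V}) : linear (gproj W).
Proof. by move=> a x y; rewrite /gproj !linearP. Qed.
HB.instance Definition _ V (W : {vspace V}) :=
  GRing.isLinear.Build R (gspace V) (gspace (subvs_of W)) _ (gproj W)
    (gproj_is_linear W).

(* On W + V^*, gproj W is (w, f) |-> (w, f|_W), as vsproj W fixes W. *)
Definition sub_eigenspace V (J : 'End(gspace V)) (W : {vspace V}) :
    {vspace cplx (gspace (subvs_of W))} :=
  (cplxf (linfun (gproj W)) @:
     (gc_eigenspace J :&: cplxv (prodv W fullv)))%VS.

Lemma sub_eigenspaceP V (J : 'End(gspace V)) (W : {vspace V})
    (z : cplx (gspace (subvs_of W))) :
  reflect (exists2 f : cplx (dual V),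
             ((vsval z.1.1, f.1), (vsval z.2.1, f.2)) \in gc_eigenspace J
             & cplx_map (linfun (precomp (incl W))) f = (z.1.2, z.2.2))
          (z \in sub_eigenspace J W).
Proof.
apply: (iffP memv_imgP) => [[x]|[f fE fz]].
  rewrite memv_cap => /andP[xE]; rewrite mem_cplxv !mem_prodv => xW ->.
  case: x xE xW => [[v f] [w g]] /= xE /andP[/andP[vW _] /andP[wW _]].
  exists (f, g); rewrite cplxfE /cplx_map /= !lfunE //=.
  by rewrite !vsprojK.
exists ((vsval z.1.1, f.1), (vsval z.2.1, f.2)).
  by rewrite memv_cap fE mem_cplxv !mem_prodv /= !subvsP !memvf.
rewrite cplxfE; case: z f fz {fE} => [[w h] [w' h']] [f g].
rewrite /cplx_map !lfunE /= => -[<- <-].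
by congr (_, _); rewrite /gproj /= vsvalK.
Qed.

Definition gc_subspace V (J : 'End(gspace V)) (W : {vspace V}) : Prop :=
  (sub_eigenspace J W :&: conjv (sub_eigenspace J W))%VS = 0%VS.

Definition induced_gc V (J : 'End(gspace V)) (W : {vspace V})
    (JW : 'End(gspace (subvs_of W))) : Prop :=
  gc_structure JW /\ gc_eigenspace JW = sub_eigenspace J W.

Definition is_split V (J : 'End(gspace V)) (W : {vspace V}) : Prop :=
  exists N : {vspace V},
    [/\ (W + N)%VS = fullv, directv (W + N)
      & (J @: prodv W (Ann N) <= prodv W (Ann N))%VS].

Section Blocks.
Variables (V : vectType R) (J : 'End(gspace V)).

Definition gc11 (v : V) : V := (J (v, 0)).1.
Definition gc12 (f : dual V) : V := (J (0, f)).1.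
Definition gc21 (v : V) : dual V := (J (v, 0)).2.
Definition gc22 (f : dual V) : dual V := (J (0, f)).2.

Definition twist_fun (x : gspace V) : gspace V :=
  (gc11 x.1 - gc12 x.2, - gc21 x.1 + gc22 x.2).

Lemma twist_fun_is_linear : linear twist_fun.
Proof.
have Jl a (v w : V) : J (a *: v + w, 0) = a *: J (v, 0) + J (w, 0).
  by rewrite -linearP; congr (J (_, _)); rewrite /= scaler0 addr0.
have Jr a (f g : dual V) : J (0, a *: f + g) = a *: J (0, f) + J (0, g).
  by rewrite -linearP; congr (J (_, _)); rewrite /= scaler0 addr0.
move=> a [v f] [w g]; congr (_, _); rewrite /gc11 /gc12 /gc21 /gc22 Jl Jr /=.
  by rewrite scalerBr opprD addrACA.
by rewrite scalerDr scalerN opprD addrACA.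
Qed.
HB.instance Definition _ :=
  GRing.isLinear.Build R (gspace V) (gspace V) _ twist_fun twist_fun_is_linear.

Definition twist : 'End(gspace V) := linfun twist_fun.

End Blocks.

Section DirectSum.
Variables (U V : vectType R).
Variables (JU : 'End(gspace U)) (JV : 'End(gspace V)).

Definition in1 (u : U) : (U * V)%type := (u, 0).
Definition in2 (v : V) : (U * V)%type := (0, v).

Lemma in1_is_linear : linear in1.
Proof. by move=> a x y; congr (_, _); rewrite /= scaler0 addr0. Qed.
Lemma in2_is_linear : linear in2.
Proof. by move=> a x y; congr (_, _); rewrite /= scaler0 addr0. Qed.
HB.instance Definition _ :=
  GRing.isLinear.Build R U (U * V)%type _ in1 in1_is_linear.
HB.instance Definition _ :=
  GRing.isLinear.Build R V (U * V)%type _ in2 in2_is_linear.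

Definition gpart1 (x : gspace (U * V)%type) : gspace U :=
  (x.1.1, precomp (linfun in1) x.2).
Definition gpart2 (x : gspace (U * V)%type) : gspace V :=
  (x.1.2, precomp (linfun in2) x.2).

Definition gjoin (x : gspace U) (y : gspace V) : gspace (U * V)%type :=
  ((x.1, y.1), precomp (linfun fst) x.2 + precomp (linfun snd) y.2).

Definition dsum_fun (x : gspace (U * V)%type) : gspace (U * V)%type :=
  gjoin (JU (gpart1 x)) (JV (gpart2 x)).

Lemma dsum_fun_is_linear : linear dsum_fun.
Proof.
move=> a x y; rewrite /dsum_fun.
have -> : gpart1 (a *: x + y) = a *: gpart1 x + gpart1 y.
  by rewrite /gpart1 !linearP.
have -> : gpart2 (a *: x + y) = a *: gpart2 x + gpart2 y.
  by rewrite /gpart2 !linearP.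
rewrite !linearP /gjoin !linearP; congr (_, _) => /=.
by rewrite scalerDr addrACA.
Qed.
HB.instance Definition _ :=
  GRing.isLinear.Build R (gspace (U * V)%type) (gspace (U * V)%type) _ dsum_fun
    dsum_fun_is_linear.

Definition dsum : 'End(gspace (U * V)%type) := linfun dsum_fun.

Lemma gjoinK x : gjoin (gpart1 x) (gpart2 x) = x.
Proof.
case: x => [[u v] f]; congr (_, _); apply/lfunP => -[u' v'] /=.
rewrite add_lfunE !comp_lfunE !lfunE /= -linearD; congr (f _).
by congr (_, _); rewrite /= (addr0, add0r).
Qed.

End DirectSum.

Definition twisted_product U V (JU : 'End(gspace U)) (JV : 'End(gspace V)) :
    'End(gspace (U * V)%type) :=
  dsum (twist JU) JV.

Definition gen_isotropic X (J : 'End(gspace X)) (U : {vspace X}) : Prop :=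
  (J @: prodv U 0 <= prodv U (Ann U))%VS.

Definition diag V (W : {vspace V}) (w : subvs_of W) : (subvs_of W * V)%type :=
  (w, vsval w).

Lemma diag_is_linear V (W : {vspace V}) : linear (@diag V W).
Proof. by move=> a x y; rewrite /diag linearP. Qed.
HB.instance Definition _ V (W : {vspace V}) :=
  GRing.isLinear.Build R (subvs_of W) (subvs_of W * V)%type _ (@diag V W)
    (@diag_is_linear V W).

Definition graph V (W : {vspace V}) : {vspace (subvs_of W * V)%type} :=
  limg (linfun (@diag V W)).

Definition graph_condition V (J : 'End(gspace V)) (W : {vspace V})
    (JW : 'End(gspace (subvs_of W))) : Prop :=
  gen_isotropic (twisted_product JW J) (graph W).

End GeneralizedComplex.

(* Main.v *)
Require Import Defs.
From HB Require Import structures.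
From mathcomp Require Import all_boot all_order all_algebra.
From mathcomp Require Import complex.
From mathcomp Require Import reals.

(** Let [V = W + N] with [S := W + Ann N] stable under [J].  Extending covectors
    on [W] by zero along [N] identifies [W + W^*] isometrically with [S], so
    [J] restricts to a GC structure [JW] on [W].  If [(p1, p2)] lies in [E_W],
    then the lifts to [S] of [JW p1 + p2] and [JW p2 - p1] are sums of terms
    [(0, a)] and [J (0, a)] with [a] in [Ann W], so they are orthogonal to [S]
    and vanish by nondegeneracy.  Hence [E_W] is the eigenspace of [JW].
    Finally [J (w, 0)] is the lift of [JW (w, 0)], and the sign in the twist
    makes the two covectors cancel on the graph. *)

Set Implicit Arguments.
Unset Strict Implicit.
Unset Printing Implicit Defensive.

Import GRing.Theory Num.Theory.

Local Open Scope ring_scope.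

Lemma precompE (K : fieldType) (U V : vectType K) (g : 'Hom(U, V)) (f : dual V)
  (u : U) : precomp g f u = f (g u).
Proof. exact: comp_lfunE. Qed.

Section Pairing.
Variables (R : realType) (V : vectType R).
Implicit Types (x y : gspace V) (J : 'End(gspace V)).

Lemma pairingDl x y z : pairing (x + y) z = pairing x z + pairing y z.
Proof. by rewrite /pairing /= add_lfunE linearD /= addrACA mulrDr. Qed.

Lemma pairingNl x y : pairing (- x) y = - pairing x y.
Proof. by rewrite /pairing /= opp_lfunE linearN /= -opprD mulrN. Qed.

Lemma dual_separates (v : V) : (forall f : dual V, f v = 0) -> v = 0.
Proof.
move=> fv0; rewrite (coord_vbasis (memvf v)) big1 // => i _.
have := fv0 (linfun (coord (vbasis {:V}) i : V -> R^o)).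
by rewrite lfunE /= => ->; rewrite scale0r.
Qed.

Lemma pairing_nondegenerate x : (forall y, pairing x y = 0) -> x = 0.
Proof.
have half_neq0 : - 2^-1 != 0 :> R by rewrite oppr_eq0 invr_eq0 pnatr_eq0.
case: x => v f x0; congr (_, _).
  apply: dual_separates => g; have /eqP := x0 (0, g).
  by rewrite /pairing /= linear0 add0r mulf_eq0 (negPf half_neq0) => /eqP.
apply/lfunP => w; have /eqP := x0 (w, 0).
by rewrite /pairing /= !zero_lfunE addr0 mulf_eq0 (negPf half_neq0) => /eqP.
Qed.

Lemma gc_skew J x y :
  gc_structure J -> pairing (J x) y = - pairing x (J y).
Proof. by move=> [Jorth J2]; rewrite -Jorth J2 pairingNl. Qed.

(** As [J] is real, the conjugate of its [+i]-eigenspace is its [-i]-eigenspace; for [z1 + i z2] in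
    both, [J z1] and [J z2] equal their own negatives. *)
Lemma gc_eigenspace_cap_conj J :
  (gc_eigenspace J :&: conjv (gc_eigenspace J))%VS = 0%VS.
Proof.
apply/eqP; rewrite -subv0; apply/subvP => -[z1 z2].
rewrite memv_cap mem_conjv !mem_gc_eigenspace /= opprK memv0.
have eqNr0 (x : gspace V) : x = - x -> x = 0.
  move/eqP; rewrite -addr_eq0 -mulr2n -scaler_nat scaler_eq0 pnatr_eq0 /=.
  by move/eqP.
case/andP=> /andP[/eqP J1 /eqP J2] /andP[/eqP J1' /eqP J2'].
have z10 : z1 = 0 by apply: eqNr0; rewrite -[LHS]J2' linearN /= J2.
have z20 : z2 = 0 by apply: eqNr0; rewrite -J1 J1'.
by rewrite z10 z20.
Qed.

(** Every real [x] is the real part of the eigenvector [x - i J x], whose imaginary part determines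
    [J x]. *)
Lemma gc_eigenspace_inj J J' : gc_structure J ->
  gc_eigenspace J = gc_eigenspace J' -> J = J'.
Proof.
move=> [_ J2] EJ; apply/lfunP => x.
have: ((x, - J x) : cplx (gspace V)) \in gc_eigenspace J.
  by rewrite mem_gc_eigenspace /= opprK linearN /= J2 opprK !eqxx.
by rewrite EJ mem_gc_eigenspace /= opprK => /andP[/eqP ->].
Qed.

End Pairing.

Section Lift.
Variables (R : realType) (V : vectType R) (W N : {vspace V}).
Hypotheses (WN : (W + N)%VS = fullv) (dWN : directv (W + N)).

(** [vsproj W] alone projects along an arbitrary complement; applying [daddv_pi W N] first makes [N]
    the kernel. *)
Definition split_proj : 'Hom(V, subvs_of W) :=
  (linfun (vsproj W) \o daddv_pi W N)%VF.

Lemma split_projE v : vsval (split_proj v) = daddv_pi W N v.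
Proof. by rewrite comp_lfunE lfunE /= vsprojK ?memv_pi. Qed.

Lemma split_proj_val (w : subvs_of W) : split_proj (vsval w) = w.
Proof.
apply: val_inj; rewrite /= split_projE daddv_pi_id ?subvsP //.
exact/directv_addP.
Qed.

Lemma split_proj_kernel v : v - vsval (split_proj v) \in N.
Proof.
have cap0 : (W :&: N = 0)%VS by apply/directv_addP.
rewrite split_projE.
have {1}<- := @daddv_pi_add _ _ W N v cap0; last by rewrite WN memvf.
by rewrite addrAC subrr add0r memv_pi.
Qed.

Lemma split_proj0 v : v \in N -> split_proj v = 0.
Proof.
move=> vN; apply: val_inj; apply/eqP; rewrite /= -memv0.
rewrite -(directv_addP dWN) memv_cap subvsP /=.
by rewrite -[vsval _](subKr v) memvB ?split_proj_kernel.
Qed.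

Definition glift (p : gspace (subvs_of W)) : gspace V :=
  (vsval p.1, precomp split_proj p.2).

Lemma glift_is_linear : linear glift.
Proof. by move=> a x y; rewrite /glift !linearP. Qed.
HB.instance Definition _ :=
  GRing.isLinear.Build R (gspace (subvs_of W)) (gspace V) _ glift
    glift_is_linear.

Lemma glift_mem p : glift p \in prodv W (Ann N).
Proof.
rewrite mem_prodv subvsP /=; apply/AnnP => v vN.
by rewrite precompE split_proj0 // linear0.
Qed.

Lemma precomp_inclK (f : dual (subvs_of W)) :
  precomp (incl W) (precomp split_proj f) = f.
Proof. by apply/lfunP => w; rewrite !precompE inclE split_proj_val. Qed.

Lemma gliftK : cancel glift (gproj W).
Proof. by case=> w f; rewrite /gproj vsvalK precomp_inclK. Qed.

(** A covector killing [N] takes the same value at [u] and at the [W]-component of [u], so its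
    restriction to [W] recovers it. *)
Lemma gprojK x : x \in prodv W (Ann N) -> glift (gproj W x) = x.
Proof.
case: x => v f; rewrite mem_prodv /= => /andP[vW /AnnP fN].
rewrite /glift /gproj /= vsprojK //; congr (_, _); apply/lfunP => u.
rewrite !precompE inclE; apply/eqP; rewrite -subr_eq0 -opprB -linearB oppr_eq0.
by rewrite /= fN ?split_proj_kernel.
Qed.

Lemma pairing_glift p q : pairing (glift p) (glift q) = pairing p q.
Proof. by rewrite /pairing /= !precompE !split_proj_val. Qed.

Lemma pairing_Ann (a : dual V) x :
  a \in Ann W -> x.1 \in W -> pairing (0, a) x = 0.
Proof.
by move=> /AnnP a0 xW; rewrite /pairing /= a0 // linear0 addr0 mulr0.
Qed.

Variable J : 'End(gspace V).
Hypotheses (Jgc : gc_structure J).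
Hypothesis (Jstab : (J @: prodv W (Ann N) <= prodv W (Ann N))%VS).

Definition split_gc : 'End(gspace (subvs_of W)) :=
  linfun (gproj W \o J \o glift).

Lemma split_gcE p : split_gc p = gproj W (J (glift p)).
Proof. by rewrite lfunE. Qed.

Lemma glift_split_gc p : glift (split_gc p) = J (glift p).
Proof.
by rewrite split_gcE gprojK //; apply/(subvP Jstab)/memv_img/glift_mem.
Qed.

Lemma split_gc_structure : gc_structure split_gc.
Proof.
split=> [p q|p].
  by rewrite -pairing_glift !glift_split_gc Jgc.1 pairing_glift.
by rewrite split_gcE glift_split_gc Jgc.2 linearN /= gliftK.
Qed.

(** Two covectors with the same restriction to [W] differ by an element of [Ann W]. *)
Lemma glift_add_Ann (w : subvs_of W) (f : dual V) :
  exists2 a, a \in Ann W &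
    (vsval w, f) = glift (w, precomp (incl W) f) + (0, a).
Proof.
exists (f - precomp split_proj (precomp (incl W) f)).
  apply/AnnP => v vW; rewrite add_lfunE opp_lfunE !precompE inclE.
  by rewrite -{2}[v](vsprojK vW) split_proj_val vsprojK ?subrr.
by congr (_, _); rewrite /= ?addr0 // addrC subrK.
Qed.

(** Replacing each covector by the extension by zero along [N] of its restriction to [W] changes the
    equation only by [(0, a2)] and [J (0, a1)], both orthogonal to [W + Ann N]. *)
Lemma split_gc_eq (w1 w2 : subvs_of W) (f1 f2 : dual V) :
  J (vsval w1, f1) = (vsval w2, f2) ->
  split_gc (w1, precomp (incl W) f1) = (w2, precomp (incl W) f2).
Proof.
have [a1 a1W ->] := glift_add_Ann w1 f1; have [a2 a2W ->] := glift_add_Ann w2 f2.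
set p := (w1, _); set q := (w2, _); rewrite linearD /= => Jpq.
apply/eqP; rewrite -subr_eq0; apply/eqP/pairing_nondegenerate => r.
have -> : pairing (split_gc p - q) r = pairing ((0, a2) - J (0, a1)) (glift r).
  rewrite -pairing_glift linearB /= glift_split_gc; congr (pairing _ _).
  by apply/eqP; rewrite subr_eq addrAC [_ + glift q]addrC -Jpq addrK.
(* Skewness moves [J] onto [glift r], which it keeps in [W + Ann N]; each term then pairs a covector
   of [Ann W] with an element whose vector part lies in [W]. *)
rewrite pairingDl pairingNl (gc_skew _ _ Jgc) -glift_split_gc.
by rewrite !pairing_Ann ?subvsP // opprK addr0.
Qed.

Lemma split_gc_eigenspace : gc_eigenspace split_gc = sub_eigenspace J W.
Proof.
apply/vspaceP => -[[w1 h1] [w2 h2]]; rewrite mem_gc_eigenspace /=.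
apply/andP/sub_eigenspaceP => [[/eqP J1 /eqP J2]|[[f1 f2]]] /=.
  (* Of all covectors extending [h1] and [h2], those vanishing on [N] are taken, so that stability
     under [J] applies. *)
  exists (precomp split_proj h1, precomp split_proj h2).
    rewrite mem_gc_eigenspace /= -[(vsval w1, _)]/(glift (w1, h1)).
    rewrite -[(vsval w2, _)]/(glift (w2, h2)).
    by rewrite -!glift_split_gc J1 J2 linearN !eqxx.
  by rewrite /cplx_map !lfunE /= !precomp_inclK.
rewrite mem_gc_eigenspace /cplx_map /= !(lfunE (precomp (incl W))) /=.
move=> /andP[/eqP J1 /eqP J2].
case=> <- <-; split; apply/eqP; last exact: split_gc_eq.
(* The eigenvector equation for [x + i y] reads [J x = - y] and [J y = x]; the first half needs a
   negated target. *)
rewrite [LHS](@split_gc_eq w1 (- w2) f1 (- f2)); last by rewrite J1.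
by rewrite linearN.
Qed.

Lemma split_gc_graph : graph_condition J split_gc.
Proof.
apply/subvP => _ /memv_imgP[[u h] +] ->.
rewrite mem_prodv memv0 /= => /andP[/memv_imgP[w _ ->] /eqP ->].
(* The zero covector extends by zero to the zero covector, so [(w, 0)] lifts to [(vsval w, 0)]. *)
have JwE : J (vsval w, 0) = glift (split_gc (w, 0)).
  by rewrite glift_split_gc /glift /= linear0.
rewrite lfunE /= /dsum_fun /gpart1 /gpart2 !lfunE /= !linear0 JwE.
rewrite /twist_fun /gc11 /gc12 /gc21 /gc22 /=.
rewrite -[(0, 0)]/(0 : gspace (subvs_of W)) linear0 /= subr0 addr0.
(* The image has vector part [(a, a)], which is on the graph; at [(w', w')] its covector part gives
   [- b w' + b w' = 0], the first sign coming from the twist. *)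
case: (split_gc (w, 0)) => a b; rewrite mem_prodv /=; apply/andP; split.
  by apply/memv_imgP; exists a; rewrite ?memvf // lfunE.
apply/AnnP => _ /memv_imgP[w' _ ->].
rewrite add_lfunE !precompE (lfunE (@diag R V W)) (lfunE fst) (lfunE snd) /=.
by rewrite split_proj_val opp_lfunE addNr.
Qed.

End Lift.

Theorem theorem1 (R : realType) (V : vectType R) (J : 'End(gspace V))
    (W : {vspace V}) :
  gc_structure J -> is_split J W ->
  gc_subspace J W /\
  (exists! JW : 'End(gspace (subvs_of W)), induced_gc J JW) /\
  (forall JW : 'End(gspace (subvs_of W)),
     induced_gc J JW -> graph_condition J JW).
Proof.
move=> Jgc [N [WN dWN Jstab]].
have E := split_gc_eigenspace WN dWN Jgc Jstab.
have JWgc := split_gc_structure WN dWN Jgc Jstab.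
(* Equal eigenspaces force equal structures, so the graph condition need only be checked for
   [split_gc]. *)
have uniqJW JW : induced_gc J JW -> split_gc W N J = JW.
  by case=> _ EW; apply: (gc_eigenspace_inj JWgc); apply: etrans E (esym EW).
split; first by rewrite /gc_subspace -E; apply: gc_eigenspace_cap_conj.
split; first by exists (split_gc W N J).
by move=> JW /uniqJW <-; apply: split_gc_graph.
Qed.
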